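(* For the minimization problem $\min_x F(x)$ with $F=f+P$ and Algorithm 1 described in the context: Algorithm 1 is well-defined at each iteration. Moreover, $x^t,y^t,z^t\in\mathcal S$ and $n_t\le N$ for all $t\ge 1$, where $$\mathcal S=\left\{x\in\mathrm{dom}(P):\|x-x^*\|\le\frac{\sqrt{2\gamma_0}\,r_0}{\alpha_0}\right\},\qquad N=\left\lceil\frac{\log(\gamma_0L_{\widehat{\mathcal S}})}{\log(1/\delta)}\right\rceil_+ .$$
   Context: Problem. $f,P:\mathbb R^n\to(-\infty,\infty]$ are proper closed convex functions, $f$ is differentiable on $\mathrm{cl}(\mathrm{dom}(P))$, and $\nabla f$ is locally Lipschitz continuous on $\mathrm{cl}(\mathrm{dom}(P))$; $\mathrm{dom}(P)$ may be unbounded. (A map $\nabla h$ is locally Lipschitz continuous on $\Omega$ if for every $x\in\Omega$ there are $L_x>0$ and an open set $U_x\ni x$ such that $\nabla h$ is $L_x$-Lipschitz continuous on $U_x$.) $F=f+P$, $F^*=\min_xF(x)\in\mathbb R$ is attained, and $x^*$ is an arbitrary fixed minimizer of $F$. $\mu\ge0$ is the convexity parameter of $f$ on $\mathrm{dom}(P)$: $f(y)\ge f(x)+\langle\nabla f(x),y-x\rangle+\frac\mu2\|x-y\|^2$ for all $x\in\mathrm{dom}(P)$, $y\in\mathbb R^n$. The proximal operator of $P$ can be evaluated exactly. $\|\cdot\|$ is the Euclidean norm. Algorithm 1. Input: $\gamma_0\in(0,1/\mu]$ (with $1/0=\infty$, so $\gamma_0$ is any positive number if $\mu=0$), $0<\alpha_0\in[\sqrt{\mu\gamma_0},1]$,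 $\delta\in(0,1)$, $x^1=z^1\in\mathrm{dom}(P)$. For $t=1,2,\dots$ compute $y^t=\big((1-\alpha_t)x^t+\alpha_t(1-\beta_t)z^t\big)/(1-\alpha_t\beta_t)$, $z^{t+1}=\arg\min_x\{\gamma_t[\langle\nabla f(y^t),x\rangle+P(x)]+\frac{\alpha_t}2\|x-\beta_ty^t-(1-\beta_t)z^t\|^2\}$, $x^{t+1}=(1-\alpha_t)x^t+\alpha_tz^{t+1}$, where $\gamma_t=\gamma_0\delta^{n_t}$, $\beta_t=\mu\gamma_t\alpha_t^{-1}$, $\alpha_t\in(0,1]$ is the solution of $\gamma_{t-1}\alpha_t^2=(1-\alpha_t)\alpha_{t-1}^2\gamma_t+\mu\alpha_t\gamma_t\gamma_{t-1}$, and $n_t$ is the smallest non-negative integer such that $2\gamma_t\big(f(x^{t+1})-f(y^t)-\langle\nabla f(y^t),x^{t+1}-y^t\rangle\big)\le\|x^{t+1}-y^t\|^2$. Constants. $r_0=\sqrt{F(x^1)-F(x^* )+\frac{\alpha_0^2}{2\gamma_0}\|x^1-x^*\|^2}$. $L_{\mathcal S}>0$ is a Lipschitz constant of $\nabla f$ on $\mathcal S$ (it exists), $\widehat{\mathcal S}=\{x\in\mathrm{dom}(P):\|x-x^*\|\le(1+\gamma_0L_{\mathcal S})\sqrt{2\gamma_0}\,r_0/\alpha_0\}$, and $L_{\widehat{\mathcal S}}>0$ is a Lipschitz constant of $\nabla f$ on $\widehat{\mathcal S}$ (it exists). $\lceil\omega\rceil_+=\max\{\lceil\omega\rceil,0\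}$.
   Formalization: If γ_0=1/μ and n_t=0 is tried, then α_t=β_t=1 and the formula for y^t is 0/0; there y^t is taken to be its continuous extension (α_tγ_{t-1}x^t+α_{t-1}^2γ_tz^t)/(α_tγ_{t-1}+α_{t-1}^2γ_t). *)

(* Defs.v *)
From HB Require Import structures.
From mathcomp Require Import all_boot all_order all_algebra.
From mathcomp Require Import all_classical all_reals all_analysis.

Set Implicit Arguments.
Unset Strict Implicit.
Unset Printing Implicit Defensive.

Import Order.TTheory GRing.Theory Num.Theory.
Import numFieldNormedType.Exports.

Local Open Scope classical_set_scope.
Local Open Scope ring_scope.

Section Euclidean.
Context {R : realType} {n : nat}.
Implicit Types u v : 'rV[R]_n.

(* The library norm `|u| on row vectors is the sup norm (same topology). *)
Definition dot u v : R := \sum_(i < n) u 0 i * v 0 i.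
Definition l2norm u : R := Num.sqrt (dot u u).

End Euclidean.

Section ExtendedFunctions.
Context {R : realType} {n : nat}.
Implicit Types h : 'rV[R]_n -> \bar R.

Definition domain h : set 'rV[R]_n := [set x | (h x < +oo)%E].

Definition proper h : Prop :=
  (forall x, (-oo < h x)%E) /\ (exists x, (h x < +oo)%E).

Definition econvex h : Prop := forall x y (t : R), 0 <= t <= 1 ->
  (h (t *: x + (1 - t) *: y)%R <= t%:E * h x + (1 - t)%:E * h y)%E.

(* For proper functions, closedness is lower semicontinuity. *)
Definition proper_closed_convex h : Prop :=
  [/\ proper h, lower_semicontinuous h & econvex h].

(* Finiteness is required near x because [fine] sends +oo to 0. *)
Definition ediff h (x : 'rV[R]_n) : Prop :=
  (\forall y \near x, h y \is a fin_num) /\ differentiable (fine \o h) x.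

(* Meaningful at the points x such that [ediff h x]. *)
Definition grad h (x : 'rV[R]_n) : 'rV[R]_n :=
  \row_(i < n) 'd (fine \o h) x (delta_mx 0 i).

Definition grad_lipschitz_on h (L : R) (A : set 'rV[R]_n) : Prop :=
  forall x y, A x -> A y ->
    l2norm (grad h x - grad h y) <= L * l2norm (x - y).

(* The neighborhoods U need not be contained in A. *)
Definition grad_locally_lipschitz_on h (A : set 'rV[R]_n) : Prop :=
  forall x, A x -> exists L : R, exists U : set 'rV[R]_n,
    [/\ 0 < L, open U, U x, (forall y, U y -> ediff h y) &
        grad_lipschitz_on h L U].

Definition convexity_parameter_on h (A : set 'rV[R]_n) (mu : R) : Prop :=
  forall x y, A x ->
    (h x + (dot (grad h x) (y - x) + mu / 2 * l2norm (x - y) ^+ 2)%:E <= h y)%E.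

Definition is_argmin h (x : 'rV[R]_n) : Prop := forall y, (h x <= h y)%E.

End ExtendedFunctions.

Section Algorithm.
Context {R : realType} {n : nat}.
Variables (f P : 'rV[R]_n -> \bar R) (mu gamma0 alpha0 delta : R).
Variable x1 : 'rV[R]_n.

(* Quantities computed from a trial step size g; gp, ap, x, z stand for
   gamma_(t-1), alpha_(t-1), x^t, z^t. *)
Record trial := Trial {
  tr_alpha : R; tr_beta : R;
  tr_y : 'rV[R]_n; tr_z : 'rV[R]_n; tr_x : 'rV[R]_n }.

Definition alpha_solution (gp ap g a : R) : Prop :=
  0 < a <= 1 /\ gp * a ^+ 2 = (1 - a) * ap ^+ 2 * g + mu * a * g * gp.

(* 1 - a * b = 1 - mu * g vanishes exactly when mu * g = 1, which may happen
   only if gamma0 = 1 / mu and the line search tries exponent 0; then a = b = 1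
   and the defining quotient reads 0 / 0. Whenever 1 - a * b != 0, the equation
   for a shows that the weights of x and z in the quotient are proportional to
   a * gp and ap ^+ 2 * g; this gives the continuous extension used when
   1 - a * b = 0. *)
Definition extrapolation (gp ap g a b : R) (x z : 'rV[R]_n) : 'rV[R]_n :=
  if 1 - a * b == 0 then
    (a * gp + ap ^+ 2 * g)^-1 *: ((a * gp) *: x + (ap ^+ 2 * g) *: z)
  else (1 - a * b)^-1 *: ((1 - a) *: x + (a * (1 - b)) *: z).

Definition prox_objective (g a b : R) (y z u : 'rV[R]_n) : \bar R :=
  (g%:E * ((dot (grad f y) u)%:E + P u)
   + (a / 2 * l2norm (u - b *: y - (1 - b) *: z) ^+ 2)%:E)%E.

Definition is_trial (gp ap : R) (x z : 'rV[R]_n) (g : R) (s : trial) : Prop :=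
  [/\ alpha_solution gp ap g (tr_alpha s),
      tr_beta s = mu * g * (tr_alpha s)^-1,
      tr_y s = extrapolation gp ap g (tr_alpha s) (tr_beta s) x z,
      is_argmin (prox_objective g (tr_alpha s) (tr_beta s) (tr_y s) z) (tr_z s) &
      tr_x s = (1 - tr_alpha s) *: x + tr_alpha s *: tr_z s].

Definition accepted (g : R) (s : trial) : Prop :=
  ((2 * g)%:E * (f (tr_x s) - f (tr_y s)
                 - (dot (grad f (tr_y s)) (tr_x s - tr_y s))%:E)
   <= (l2norm (tr_x s - tr_y s) ^+ 2)%:E)%E.

Definition passes (gp ap : R) (x z : 'rV[R]_n) (m : nat) : Prop :=
  exists s, is_trial gp ap x z (gamma0 * delta ^+ m) s /\
            accepted (gamma0 * delta ^+ m) s.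

Definition iteration_well_defined (gp ap : R) (x z : 'rV[R]_n) : Prop :=
  [/\ forall m, exists! s, is_trial gp ap x z (gamma0 * delta ^+ m) s,
      forall m s, is_trial gp ap x z (gamma0 * delta ^+ m) s ->
        ediff f (tr_y s) /\ f (tr_x s) \is a fin_num &
      exists m, passes gp ap x z m].

(* gam and alp are indexed from 0; the other sequences from 1 (their value at 0
   is irrelevant). *)
Record execution := Execution {
  gam : nat -> R; alp : nat -> R; bet : nat -> R; nls : nat -> nat;
  xs : nat -> 'rV[R]_n; ys : nat -> 'rV[R]_n; zs : nat -> 'rV[R]_n }.

Definition starts (e : execution) : Prop :=
  [/\ gam e 0 = gamma0, alp e 0 = alpha0, xs e 1 = x1 & zs e 1 = x1].

Definition iteration (e : execution) (t : nat) : Prop :=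
  let ok := passes (gam e t.-1) (alp e t.-1) (xs e t) (zs e t) in
  [/\ ok (nls e t), forall m, (m < nls e t)%N -> ~ ok m,
      gam e t = gamma0 * delta ^+ nls e t &
      is_trial (gam e t.-1) (alp e t.-1) (xs e t) (zs e t) (gam e t)
        (Trial (alp e t) (bet e t) (ys e t) (zs e t.+1) (xs e t.+1))].

Definition run_upto (T : nat) (e : execution) : Prop :=
  starts e /\ forall t, (1 <= t <= T)%N -> iteration e t.

Definition run (e : execution) : Prop :=
  starts e /\ forall t, (1 <= t)%N -> iteration e t.

End Algorithm.

Section Constants.
Context {R : realType} {n : nat}.
Variables (f P : 'rV[R]_n -> \bar R) (gamma0 alpha0 delta : R).
Variables (x1 xstar : 'rV[R]_n).

Definition objective (x : 'rV[R]_n) : \bar R := (f x + P x)%E.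

Definition r0 : R :=
  Num.sqrt (fine (objective x1) - fine (objective xstar)
            + alpha0 ^+ 2 / (2 * gamma0) * l2norm (x1 - xstar) ^+ 2).

Definition setS : set 'rV[R]_n :=
  [set x | domain P x /\
           l2norm (x - xstar) <= Num.sqrt (2 * gamma0) * r0 / alpha0].

Definition setShat (LS : R) : set 'rV[R]_n :=
  [set x | domain P x /\
           l2norm (x - xstar) <=
             (1 + gamma0 * LS) * Num.sqrt (2 * gamma0) * r0 / alpha0].

Definition ceil_plus (w : R) : int := Num.max (Num.ceil w) 0.

Definition line_search_bound (LShat : R) : int :=
  ceil_plus (ln (gamma0 * LShat) / ln (1 / delta)).

End Constants.

(* Main.v *)
Require Import Defs.
From HB Require Import structures.
From mathcomp Require Import all_boot all_order all_algebra ring lra.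
From mathcomp Require Import all_classical all_reals all_analysis.

Import Order.TTheory GRing.Theory Num.Theory.
Import numFieldNormedType.Exports.

Local Open Scope classical_set_scope.
Local Open Scope ring_scope.

(** Write gap x = F(x) - F(xstar), q = alpha^2/(2 gamma) and
    E = gap x + q |z - xstar|^2 for a state (gamma, alpha, x, z). In these terms
    the quadratic equation for alpha_t says exactly
      q_t = (1 - alpha_t) q_(t-1) + alpha_t mu / 2          ([alpha_weight]).
    For an accepted trial, the line-search inequality, the convexity of P, the
    strong convexity of f at y and the three-point inequality of the proximal
    step add up to E_t <= (1 - alpha_t) E_(t-1)       ([lyapunov_decrease]):
    since x' - y = alpha (z' - w), with w = beta y + (1 - beta) z, the quadratic
    terms of the line search and of the proximal step cancel, and q beta =
    alpha mu / 2 cancels the strong convexity term. As q_t >= (1 - alpha_t)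
    q_(t-1), the inequality E <= q rho^2, where rho = sqrt(2 gamma_0) r_0 /
    alpha_0 is the radius of S, passes from one state to the next. It is an
    equality at the start, and it puts z in S because gap >= 0. The points x
    and y are convex combinations of points of S.

    For the line search, neither the trial points nor alpha are known in
    advance, so a bound uniform in the trial step g <= gamma_0 is needed. The
    point xstar solves its own proximal problem ([xstar_optimality]); comparing it
    with z' gives alpha |z' - xstar| <= alpha rho + g L_S rho, and averaging with x
    puts x' in Shat ([trial_in_ball]). On the convex set Shat the descent
    inequality holds with the constant L_Shat, so every g with g L_Shat <= 1 is
    accepted ([small_step_accepted]). As gamma_0 delta^m L_Shat <= 1 for m = N,
    the search stops at N or before.

    The existence of the constants L_S and L_Shat is a compactness argument:
    a map that is Lipschitz near each point of a compact set is Lipschitz on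
    it ([lipschitz_on_compact]). The proximal point exists because P has a
    minorant of linear growth ([pcc_minorant]), so that the proximal objective
    may be minimized over a ball. The descent inequality and the optimality
    condition at xstar both come from the gradient inequality and the Lipschitz
    continuity of the gradient, with no derivative along a segment. *)

(** * Euclidean geometry of row vectors *)

Section Euclid.
Context {R : realType} {n : nat}.
Implicit Types u v w : 'rV[R]_n.

Lemma dotC u v : dot u v = dot v u.
Proof. by apply: eq_bigr => i _; rewrite mulrC. Qed.

Lemma dotDl u v w : dot (u + v) w = dot u w + dot v w.
Proof. by rewrite -big_split; apply: eq_bigr => i _; rewrite mxE mulrDl. Qed.

Lemma dotZl a u v : dot (a *: u) v = a * dot u v.
Proof. by rewrite mulr_sumr; apply: eq_bigr => i _; rewrite mxE mulrA. Qed.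

Lemma dotNl u v : dot (- u) v = - dot u v.
Proof. by rewrite -scaleN1r dotZl mulN1r. Qed.

Lemma dotDr u v w : dot u (v + w) = dot u v + dot u w.
Proof. by rewrite dotC dotDl !(dotC u). Qed.

Lemma dotZr a u v : dot u (a *: v) = a * dot u v.
Proof. by rewrite dotC dotZl (dotC u). Qed.

Lemma dotNr u v : dot u (- v) = - dot u v.
Proof. by rewrite dotC dotNl (dotC u). Qed.

Definition dotE := (dotDl, dotDr, dotNl, dotNr, dotZl, dotZr).

Lemma dot_ge0 u : 0 <= dot u u.
Proof. by apply: sumr_ge0 => i _; rewrite -expr2 sqr_ge0. Qed.

Lemma l2norm_sqr u : l2norm u ^+ 2 = dot u u.
Proof. by rewrite sqr_sqrtr // dot_ge0. Qed.

Lemma l2norm_ge0 u : 0 <= l2norm u. Proof. exact: sqrtr_ge0. Qed.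

Lemma l2normZ a u : l2norm (a *: u) = `|a| * l2norm u.
Proof. by rewrite /l2norm !dotE mulrA -expr2 sqrtrM ?sqr_ge0// sqrtr_sqr. Qed.

Lemma l2normN u : l2norm (- u) = l2norm u.
Proof. by rewrite -scaleN1r l2normZ normrN1 mul1r. Qed.

Lemma l2norm_distC u v : l2norm (u - v) = l2norm (v - u).
Proof. by rewrite -l2normN opprB. Qed.

Lemma dot_eq0 u : dot u u = 0 -> u = 0.
Proof.
move=> /eqP; rewrite psumr_eq0; last by move=> i _; rewrite -expr2 sqr_ge0.
move=> /allP h; apply/rowP => i; rewrite mxE; apply/eqP.
by have := h i (mem_index_enum i); rewrite -expr2 sqrf_eq0.
Qed.

Lemma l2norm_eq0 u : l2norm u = 0 -> u = 0.
Proof. by move=> u0; apply: dot_eq0; rewrite -l2norm_sqr u0 expr0n. Qed.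

Lemma cauchy_schwarz u v : dot u v <= l2norm u * l2norm v.
Proof.
have [/l2norm_eq0 ->|u0] := eqVneq (l2norm u) 0.
  by rewrite -(scale0r 0) dotZl mul0r mulr_ge0 ?l2norm_ge0.
have [/l2norm_eq0 ->|v0] := eqVneq (l2norm v) 0.
  by rewrite -(scale0r 0) dotZr mul0r mulr_ge0 ?l2norm_ge0.
have ab0 : 0 < l2norm u * l2norm v by rewrite mulr_gt0 // lt_def ?u0 ?v0 l2norm_ge0.
have := dot_ge0 (l2norm v *: u - l2norm u *: v).
rewrite !dotE (dotC v u) -!l2norm_sqr => h.
rewrite -subr_ge0 -(pmulr_rge0 _ ab0); nra.
Qed.

Lemma ler_l2normD u v : l2norm (u + v) <= l2norm u + l2norm v.
Proof.
rewrite -(@ler_pXn2r _ 2) ?nnegrE ?addr_ge0 ?l2norm_ge0 //.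
rewrite l2norm_sqr !dotE (dotC v u) -!l2norm_sqr.
have := cauchy_schwarz u v; nra.
Qed.

Lemma norm_combo t u v : dot (t *: u + (1 - t) *: v) (t *: u + (1 - t) *: v) =
  t * dot u u + (1 - t) * dot v v - t * (1 - t) * dot (u - v) (u - v).
Proof. rewrite !dotE (dotC v u); ring. Qed.

Lemma l2norm_combo_le t u v r : 0 <= t <= 1 -> l2norm u <= r -> l2norm v <= r ->
  l2norm (t *: u + (1 - t) *: v) <= r.
Proof.
move=> /andP[t0 t1] ur vr; apply: le_trans (ler_l2normD _ _) _.
rewrite !l2normZ !ger0_norm ?subr_ge0 //; nra.
Qed.

(** Topological statements refer to the sup norm; this lemma and the next one
    transfer bounds between it and the Euclidean norm. *)
Lemma norm_le_l2norm u : `|u| <= l2norm u.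
Proof.
rewrite /Num.norm/= mx_normrE; apply/bigmax_leP; split=> [|[i j] _ /=].
  exact: l2norm_ge0.
rewrite (ord1 i) -sqrtr_sqr ler_sqrt ?dot_ge0 // /dot (bigD1 j) //= -expr2 lerDl.
by apply: sumr_ge0 => k _; rewrite -expr2 sqr_ge0.
Qed.

(** The factor [n.+1] instead of the sharp [Num.sqrt n] is positive for every
    [n], so that it cancels from inequalities. *)
Lemma l2norm_le_norm u : l2norm u <= n.+1%:R * `|u|.
Proof.
have c i : `|u 0 i| <= `|u|.
  rewrite /Num.norm/= mx_normrE.
  exact/(le_bigmax _ (fun ij => `|u ij.1 ij.2|) (0, i)).
rewrite -(@ler_pXn2r _ 2) ?nnegrE ?l2norm_ge0 ?mulr_ge0 //.
rewrite l2norm_sqr /dot; apply: (@le_trans _ _ (\sum_(i < n) `|u| ^+ 2)).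
  by apply: ler_sum => i _; rewrite -expr2 -real_normK ?num_real// lerXn2r ?nnegrE.
rewrite sumr_const card_ord exprMn -[leLHS]mulr_natl ler_wpM2r ?sqr_ge0//.
rewrite -natrX ler_nat (leq_trans (leqnSn n)) // -mulnn; exact: leq_pmulr.
Qed.

End Euclid.

(** * The descent inequality *)

Section Descent.
Context {R : realType} {n : nat}.
Implicit Types x y : 'rV[R]_n.

(** If the bound holds on [A] with a constant [C] in place of [L / 2], then
    applying it to the two halves of the segment from [x] to [y] gives it with
    [C / 2 + L / 4]. Starting from [C = L], which the gradient inequality
    and the Cauchy-Schwarz inequality provide, the constants tend to [L / 2]. *)
Lemma descent (A : set 'rV[R]_n) (h : 'rV[R]_n -> R) (G : 'rV[R]_n -> 'rV[R]_n) L :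
  (forall x y (t : R), 0 <= t <= 1 -> A x -> A y ->
     A (t *: x + (1 - t) *: y)) ->
  (forall x y, A x -> A y -> h x + dot (G x) (y - x) <= h y) ->
  (forall x y, A x -> A y -> l2norm (G x - G y) <= L * l2norm (x - y)) ->
  forall x y, A x -> A y ->
    h y - h x - dot (G x) (y - x) <= L / 2 * l2norm (y - x) ^+ 2.
Proof.
move=> cA gi lip.
have bound k : forall x y, A x -> A y ->
    h y - h x - dot (G x) (y - x) <= (L / 2 + L / 2 / 2 ^+ k) * l2norm (y - x) ^+ 2.
  elim: k => [|k IH] x y Ax Ay.
    have := gi y x Ay Ax; rewrite -opprB dotNr => h1.
    have h2 := cauchy_schwarz (G y - G x) (y - x).
    have := lip y x Ay Ax; have := l2norm_ge0 (y - x).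
    by move: h2; rewrite dotDl dotNl expr0 divr1; set d := l2norm (y - x);
      set ll := l2norm _ => *; nra.
  set m := 2^-1 *: x + (1 - 2^-1) *: y.
  have Am : A m by apply: cA => //; lra.
  have mx : m - x = 2^-1 *: (y - x) by rewrite /m; apply/rowP => i; rewrite !mxE; field.
  have ym : y - m = 2^-1 *: (y - x) by rewrite /m; apply/rowP => i; rewrite !mxE; field.
  have := IH _ _ Ax Am; have := IH _ _ Am Ay; rewrite mx ym l2normZ !dotZr.
  rewrite ger0_norm ?invr_ge0 //.
  have h2 := cauchy_schwarz (G m - G x) (y - x).
  have := lip m x Am Ax; rewrite mx l2normZ ger0_norm ?invr_ge0 //.
  have := l2norm_ge0 (y - x); move: h2; rewrite dotDl dotNl (exprS 2 k) invfM.
  set e := (2 ^+ k)^-1; set d := l2norm (y - x); set gm := dot (G m) _.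
  set gx := dot (G x) _; set ll := l2norm _ => *.
  nra.
move=> x y Ax Ay; apply/ler_addgt0Pr => e e0.
set c := L / 2 * l2norm (y - x) ^+ 2.
have [k hk] : exists k : nat, c / 2 ^+ k <= e.
  have [k hk] : exists k : nat, c / e < k%:R.
    by exists (Num.truncn (`|c / e|)).+1; rewrite (le_lt_trans (ler_norm _))// truncnS_gt.
  exists k; rewrite ler_pdivrMr ?exprn_gt0// mulrC -ler_pdivrMr//.
  apply: (le_trans (ltW hk)); rewrite -natrX ler_nat; exact/ltnW/ltn_expl.
have := bound k x y Ax Ay; rewrite mulrDl -/c => /le_trans; apply.
by rewrite lerD2l mulrAC.
Qed.
End Descent.

(** * Compactness arguments *)

Section Compactness.
Context {R : realType}.

(** If no minimum is attained, the sublevel sets of [h] in [K] generate a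
    filter; at a cluster point of it, [h] exceeds some value of [h] on a whole
    neighborhood, which contradicts clustering. *)
Lemma lsc_attains_min (X : topologicalType) (h : X -> \bar R) (K : set X) :
  lower_semicontinuous h -> (forall x, (-oo < h x)%E) -> compact K -> K !=set0 ->
  exists2 x, K x & forall y, K y -> (h x <= h y)%E.
Proof.
move=> lh hoo cK K0; apply: contrapT => nomin.
have better x : K x -> exists2 y, K y & (h y < h x)%E.
  move=> Kx; apply: contrapT => nb; apply: nomin; exists x => // y Ky.
  by rewrite leNgt; apply/negP => hyx; apply: nb; exists y.
pose F := filter_from K (fun y => [set x | K x /\ (h x <= h y)%E]).
have FF : ProperFilter F.
  apply: filter_from_proper; last by move=> y Ky; exists y.
  apply: filter_from_filter => // y1 y2 K1 K2.
  have [h12|/ltW h21] := leP (h y1) (h y2).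
    by exists y1 => // x [Kx hx]; split; split => //; apply: le_trans h12.
  by exists y2 => // x [Kx hx]; split; split => //; apply: le_trans h21.
have FK : F K by have [y Ky] := K0; exists y => // x [].
have [p [Kp clp]] := cK F FF FK.
have [y Ky hyp] := better p Kp.
have hy_fin : h y \is a fin_num.
  by rewrite fin_real// hoo (lt_le_trans hyp (leey _)).
have [V nV hV] : exists2 V, nbhs p V & forall x, V x -> (h y < h x)%E.
  by move: hyp; rewrite -(fineK hy_fin) => /lh.
have [x [[Kx hx] Vx]] := clp [set x | K x /\ (h x <= h y)%E] V
  (ex_intro2 _ _ y Ky (fun _ => id)) nV.
by have := hV x Vx; rewrite ltNge hx.
Qed.

Lemma lsc_addr_continuous (X : topologicalType) (h : X -> \bar R) (q : X -> R) :
  lower_semicontinuous h -> (forall x, (-oo < h x)%E) -> continuous q ->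
  lower_semicontinuous (fun x => h x + (q x)%:E)%E.
Proof.
move=> lh hoo cq x a ha.
have [e e0 he] : exists2 e : R, 0 < e & ((a - q x + e)%:E < h x)%E.
  move: ha (hoo x); case: (h x) => [r| |] //=.
    rewrite -EFinD lte_fin => ar _; exists ((r - (a - q x)) / 2); first lra.
    by rewrite lte_fin; lra.
  by move=> _ _; exists 1 => //; rewrite ltry.
have [V nV hV] := lh _ _ he.
have nq : nbhs x [set y | `|q x - q y| < e].
  by have /cvgrPdist_lt/(_ e e0) := cq x.
exists (V `&` [set y | `|q x - q y| < e]); first exact: filterI.
move=> y [Vy qy]; have := hV y Vy; case: (h y) => [r| |] //=.
  rewrite -EFinD !lte_fin; move: qy; rewrite /= ltr_norml => /andP[]; lra.
by move=> _; rewrite addye// ltry.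
Qed.

Context {n : nat}.
Local Notation V := 'rV[R]_n.
Implicit Types x y z u v w : V.

Lemma compact_sup_ball (x0 : V) r : compact [set x | `|x0 - x| <= r].
Proof.
apply: bounded_closed_compact; last exact: closed_closed_ball_.
exists (`|x0| + r); split; first exact: num_real.
move=> M hM x /= hx; apply/ltW/(le_lt_trans _ hM).
by rewrite -[x](subKr x0) (le_trans (ler_normB _ _))// lerD2l.
Qed.

Lemma continuous_dot (T : topologicalType) (a b : T -> V) :
  (forall i, continuous (fun t => a t 0 i)) ->
  (forall i, continuous (fun t => b t 0 i)) ->
  continuous (fun t => dot (a t) (b t)).
Proof.
move=> ca cb; apply: (@continuous_big R 'I_n +%R 0 xpredT) => [p|i _ t].
  exact: add_continuous.
by apply: cvgM; [exact: ca|exact: cb].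
Qed.

Lemma continuous_quadratic (c w : V) (k : R) :
  continuous (fun u : V => dot c u + k / 2 * l2norm (u - w) ^+ 2).
Proof.
have h1 : continuous (fun u : V => dot c u).
  by apply: continuous_dot => i; [exact: cst_continuous|exact: coord_continuous].
have h2 : continuous (fun u : V => l2norm (u - w) ^+ 2).
  under eq_fun do rewrite l2norm_sqr.
  have cc i : continuous (fun v : V => (v - w) 0 i).
    under eq_fun do rewrite !mxE.
    move=> u; apply: (@cvgB _ _ _ (nbhs u)); last exact: cvg_cst.
    exact: coord_continuous.
  exact: continuous_dot.
move=> u; apply: (@cvgD _ _ _ (nbhs u)); first exact: h1.
by apply: (@cvgM _ _ (nbhs u)); [exact: cvg_cst|exact: h2].
Qed.

(** The bound [L] is found by compactness of the product [K `*` K]: near a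
    diagonal point the local constant works, and near a pair of distinct points
    the distance of the arguments is bounded below while that of the images is
    bounded above. *)
Lemma lipschitz_on_compact (G : V -> V) (K : set V) : compact K ->
  (forall x, K x -> exists L : R, exists U : set V, [/\ 0 < L, open U, U x &
     forall y z, U y -> U z -> l2norm (G y - G z) <= L * l2norm (y - z)]) ->
  exists2 L : R, 0 < L &
    forall x y, K x -> K y -> l2norm (G x - G y) <= L * l2norm (x - y).
Proof.
move=> cK loc.
have /compact_near_coveringP := compact_setX cK cK.
move=> /(_ R +oo (fun L p =>
  l2norm (G p.1 - G p.2) <= L * l2norm (p.1 - p.2))) /(_ _)[].
  move=> [x y] /= [Kx Ky].
  have [Lx [Ux [Lx0 oUx Uxx lipx]]] := loc x Kx.
  have [Ly [Uy [Ly0 oUy Uyy lipy]]] := loc y Ky.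
  have [<-|xy] := eqVneq x y.
    exists (Ux `*` Ux, [set L | Lx < L]) => /=.
      split; first by exists (Ux, Ux) => //=; split; exact: open_nbhs_nbhs.
      by apply: nbhs_pinfty_gt; exact: num_real.
    move=> [[x' y'] L] /= [[Ux' Uy'] /ltW LL].
    by apply: (le_trans (lipx _ _ Ux' Uy')); rewrite ler_wpM2r ?l2norm_ge0.
  have d0 : 0 < `|x - y| by rewrite normr_gt0 subr_eq0.
  set d := `|x - y| in d0 *.
  set C : R := n.+1%:R.
  (* On balls of radius [d / 4], the images move by at most
     [(Lx + Ly) * (C * d)] in total, and the arguments stay [d / 2] apart. *)
  set M := l2norm (G x - G y) + (Lx + Ly) * (C * d).
  pose Bx := Ux `&` [set x' | `|x - x'| < d / 4].
  pose By := Uy `&` [set y' | `|y - y'| < d / 4].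
  have d4 : 0 < d / 4 by rewrite divr_gt0.
  exists (Bx `*` By, [set L | M / (d / 2) < L]) => /=.
    split; last by apply: nbhs_pinfty_gt; exact: num_real.
    exists (Bx, By) => //=; split; apply: filterI; do ?exact: open_nbhs_nbhs.
      by apply/nbhs_ballP; exists (d / 4) => // ? ; rewrite -ball_normE.
    by apply/nbhs_ballP; exists (d / 4) => // ? ; rewrite -ball_normE.
  move=> [[x' y'] L] /= [[[Ux' dx] [Uy' dy]]]; rewrite /= in dx dy *.
  rewrite ltr_pdivrMr ?divr_gt0// => ML.
  have hd : d / 2 <= l2norm (x' - y').
    apply: le_trans (norm_le_l2norm _).
    have -> : x' - y' = (x - y) - ((x - x') - (y - y')).
      by apply/rowP => i; rewrite !mxE; ring.
    apply: (le_trans _ (lerB_dist _ _)); rewrite -/d.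
    have := ler_normB (x - x') (y - y'); lra.
  have hL : 0 < L.
    rewrite -(pmulr_lgt0 _ (divr_gt0 d0 (ltr0Sn R 1))) (le_lt_trans _ ML)//.
    by rewrite addr_ge0 ?l2norm_ge0// !mulr_ge0// ?addr_ge0// ltW.
  apply: (@le_trans _ _ (L * (d / 2))); last by rewrite ler_pM2l.
  apply: le_trans (ltW ML).
  have -> : G x' - G y' = (G x - G y) + ((G x' - G x) + (G y - G y')).
    by apply/rowP => i; rewrite !mxE; ring.
  apply: (le_trans (ler_l2normD _ _)); rewrite lerD2l.
  apply: (le_trans (ler_l2normD _ _)); rewrite mulrDl.
  have C0 : 0 < C by rewrite ltr0Sn.
  apply: lerD.
    apply: (le_trans (lipx _ _ Ux' Uxx)); rewrite ler_pM2l//.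
    apply: (le_trans (l2norm_le_norm _)); rewrite ler_pM2l// distrC; lra.
  apply: (le_trans (lipy _ _ Uyy Uy')); rewrite ler_pM2l//.
  apply: (le_trans (l2norm_le_norm _)); rewrite ler_pM2l//; lra.
move=> M [_ hM]; exists (Num.max 1 (M + 1)); first by rewrite lt_max ltr01.
move=> x y Kx Ky; apply: (hM _ _ (x, y)) => //=.
by rewrite lt_max ltrDl ltr01 orbT.
Qed.

End Compactness.

(** * Proximal points of proper closed convex functions *)

Section Prox.
Context {R : realType} {n : nat}.
Notation V := 'rV[R]_n.
Implicit Types x y z u v w c : V.
Variable P : V -> \bar R.
Hypothesis hP : proper_closed_convex P.

Lemma pcc_gtNy x : (-oo < P x)%E. Proof. by case: hP => -[]. Qed.

Lemma pcc_fin x : domain P x -> P x \is a fin_num.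
Proof. by move=> Dx; rewrite fin_real// pcc_gtNy. Qed.

Lemma pccE x : domain P x -> P x = (fine (P x))%:E.
Proof. by move=> /pcc_fin/fineK. Qed.

Lemma pcc_convex x y (t : R) : 0 <= t <= 1 -> domain P x -> domain P y ->
  domain P (t *: x + (1 - t) *: y) /\
  fine (P (t *: x + (1 - t) *: y)) <= t * fine (P x) + (1 - t) * fine (P y).
Proof.
move=> t01 Dx Dy; have [_ _ /(_ x y t t01)] := hP.
rewrite (pccE x Dx) (pccE y Dy) -!EFinM -EFinD => h.
have D : domain P (t *: x + (1 - t) *: y) by rewrite /domain/= (le_lt_trans h)// ltry.
by split=> //; move: h; rewrite (pccE _ D) lee_fin.
Qed.

(** On the unit ball around [x0], [P] is bounded below by lower
    semicontinuity. If [u] is at distance [d > 1] from [x0], the point of the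
    segment from [x0] to [u] at distance 1 is in this ball, and convexity along
    the segment turns the bound there into one that is linear in [d]. *)
Lemma pcc_minorant x0 : domain P x0 -> exists A B : R, 0 <= B /\
  forall u, domain P u -> - A - B * l2norm (u - x0) <= fine (P u).
Proof.
move=> D0; set K := [set x | `|x0 - x| <= 1].
have K0 : K x0 by rewrite /K/= subrr normr0.
have [_ lP _] := hP.
have [m Km minm] := lsc_attains_min _ P K lP pcc_gtNy
  (compact_sup_ball x0 1) (ex_intro _ _ K0).
have Dm : domain P m by rewrite /domain/= (le_lt_trans (minm x0 K0)).
have minr v : K v -> domain P v -> fine (P m) <= fine (P v).
  by move=> Kv Dv; have := minm v Kv; rewrite (pccE m Dm) (pccE v Dv) lee_fin.
have pm0 := minr x0 K0 D0.
exists (- fine (P m)), (fine (P x0) - fine (P m)); split; first by rewrite subr_ge0.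
move=> u Du; rewrite opprK.
have dl : `|u - x0| <= l2norm (u - x0) by exact: norm_le_l2norm.
have := l2norm_ge0 (u - x0); set d := l2norm _ in dl * => d0.
have [d1|d1] := leP d 1.
  have : fine (P m) <= fine (P u).
    by apply: minr => //; rewrite /K/= distrC (le_trans dl).
  nra.
have t01 : 0 <= d^-1 <= 1 by rewrite invr_ge0 d0 invf_le1 ?ltW// (lt_trans ltr01).
have [Dv] := pcc_convex u x0 d^-1 t01 Du D0.
set v := _ + _ in Dv * => hv.
have dp : 0 < d by lra.
have Kv : K v.
  have -> : K v = (`|x0 - v| <= 1) by [].
  have -> : x0 - v = d^-1 *: (x0 - u) by rewrite /v; apply/rowP => i; rewrite !mxE; ring.
  by rewrite normrZ ger0_norm ?invr_ge0// distrC mulrC ler_pdivrMr// mul1r.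
have := le_trans (minr v Kv Dv) hv.
rewrite -(ler_pM2l dp) mulrDr !mulrA mulfV ?gt_eqF// mulrBr mulr1.
rewrite mulfV ?gt_eqF//.
nra.
Qed.

Definition prox_value (g a : R) c w u : R :=
  g * (dot c u + fine (P u)) + a / 2 * l2norm (u - w) ^+ 2.

Definition is_prox (g a : R) c w z : Prop :=
  domain P z /\
  forall u, domain P u -> prox_value g a c w z <= prox_value g a c w u.

(** Up to the factor [g], the objective is [psi], whose quadratic part beats
    the linear minorant of [P] at distance [rho] from a point [x0] of the
    domain. A minimizer over the ball of radius [rho] is then a global one. *)
Lemma prox_exists (g a : R) c w : 0 < g -> 0 < a -> exists z, is_prox g a c w z.
Proof.
move=> g0 a0.
have [x0 D0] : exists x, domain P x by case: hP => -[].
have [A [B [B0 AB]]] := pcc_minorant x0 D0.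
pose k := a / g; have k0 : 0 < k by rewrite divr_gt0.
pose psi u := fine (P u) + (dot c u + k / 2 * l2norm (u - w) ^+ 2).
have psiE u : prox_value g a c w u = g * psi u.
  by rewrite /prox_value /psi /k; field; rewrite gt_eqF.
suff [z Dz zmin] : exists2 z, domain P z & forall u, domain P u -> psi z <= psi u.
  by exists z; split=> // u Du; rewrite !psiE ler_pM2l// zmin.
pose C := l2norm (c + k *: (x0 - w)) + B.
pose A' := `|A + fine (P x0)|.
pose rho := 1 + 2 * (C + A') / k.
have C0 : 0 <= C by rewrite addr_ge0 ?l2norm_ge0.
have A0 : 0 <= A' by exact: normr_ge0.
have CA : 0 <= 2 * (C + A') / k.
  by apply: divr_ge0; [apply: mulr_ge0 => //; exact: addr_ge0|exact: ltW].
have far u : domain P u -> rho <= l2norm (u - x0) -> psi x0 <= psi u.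
  move=> Du hd; have := AB u Du.
  have h1 : - l2norm (c + k *: (x0 - w)) * l2norm (u - x0) <=
      dot (c + k *: (x0 - w)) (u - x0).
    by have := cauchy_schwarz (- (c + k *: (x0 - w))) (u - x0); rewrite dotNl l2normN; lra.
  have h2 : A + fine (P x0) <= A' by exact: ler_norm.
  (* Taylor expansion of the quadratic part of [psi] at [x0] *)
  have -> : psi u = fine (P u) - fine (P x0) + psi x0 +
      dot (c + k *: (x0 - w)) (u - x0) + k / 2 * l2norm (u - x0) ^+ 2.
    rewrite /psi !l2norm_sqr !dotE (dotC x0 u) (dotC w u) (dotC w x0).
    by field.
  have r1 : 1 <= rho by rewrite /rho lerDl.
  have kr : 2 * (C + A') <= k * (rho - 1).
    by rewrite /rho [1 + _]addrC addrK [k * _]mulrC divfK ?gt_eqF.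
  rewrite /C in kr *; set ll := l2norm (c + _) in h1 kr *.
  set d := l2norm (u - x0) in h1 hd *.
  have kd : (C + A') <= k / 2 * d.
    have : k * (rho - 1) <= k * d by rewrite ler_pM2l//; lra.
    by rewrite /C -/ll; lra.
  have d1 : 1 <= d by lra.
  have hh : (C + A') * d <= k / 2 * d ^+ 2.
    by rewrite expr2 mulrA ler_wpM2r//; lra.
  have : A' <= A' * d by rewrite ler_peMr.
  move: hh; rewrite /C -/ll; nra.
pose K := [set x | `|x0 - x| <= rho].
pose h u : \bar R := (P u + (dot c u + k / 2 * l2norm (u - w) ^+ 2)%:E)%E.
have hE u : domain P u -> h u = (psi u)%:E.
  by move=> Du; rewrite /h (pccE u Du) -EFinD.
have hoo u : (-oo < h u)%E.
  by have := pcc_gtNy u; rewrite /h; case: (P u) => [r| |] //; rewrite -?EFinD ?ltNyr.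
have lh : lower_semicontinuous h.
  apply: lsc_addr_continuous; [by case: hP|exact: pcc_gtNy|exact: continuous_quadratic].
have K0 : K x0.
  by rewrite /K/= subrr normr0 addr_ge0.
have [z Kz zmin] := lsc_attains_min _ h K lh hoo
  (compact_sup_ball x0 rho) (ex_intro _ _ K0).
have Dz : domain P z.
  have := zmin x0 K0; rewrite (hE x0 D0) /h /domain/= .
  by case: (P z) => //= r; rewrite ltry.
exists z => // u Du.
have [Ku|nKu] := leP (`|x0 - u|) rho.
  by have := zmin u Ku; rewrite !hE// lee_fin.
have : psi z <= psi x0 by have := zmin x0 K0; rewrite !hE// lee_fin.
move=> /le_trans; apply; apply: far => //.
by apply: le_trans (norm_le_l2norm _); rewrite distrC ltW.
Qed.

(** Used to divide an inequality between convex combinations by the weight [t]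
    and let [t] tend to 0. *)
Lemma le_of_near0 (a b e : R) :
  (forall t, 0 < t -> t <= 1 -> a <= b + t * e) -> a <= b.
Proof.
move=> h; apply/ler_addgt0Pr => d d0.
pose t := Num.min 1 (d / (`|e| + 1)).
have e1 : 0 < `|e| + 1 by rewrite ltr_wpDl.
have t0 : 0 < t by rewrite lt_min ltr01 divr_gt0.
apply: (le_trans (h t t0 _)); first by rewrite ge_min lexx.
rewrite lerD2l; apply: (@le_trans _ _ (t * (`|e| + 1))).
  by rewrite ler_pM2l// ler_wpDr// ler_norm.
by rewrite -ler_pdivlMr// ge_min lexx orbT.
Qed.

(** Minimality is compared along the segment from [z] to [u]: the quadratic
    term is strongly convex with modulus [a], so that the values at
    [t *: u + (1 - t) *: z] are smaller than the affine interpolation by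
    [a / 2 * t * (1 - t) * |u - z|^2]. *)
Lemma prox_three_point (g a : R) c w z u :
  0 <= g -> 0 <= a -> is_prox g a c w z -> domain P u ->
  prox_value g a c w z + a / 2 * l2norm (u - z) ^+ 2 <= prox_value g a c w u.
Proof.
move=> g0 a0 [Dz zmin] Du.
apply: (@le_of_near0 _ _ (a / 2 * l2norm (u - z) ^+ 2)) => t t0 t1.
have t01 : 0 <= t <= 1 by rewrite t1 ltW.
have [Dv hv] := pcc_convex u z t t01 Du Dz.
have := zmin _ Dv; rewrite /prox_value !l2norm_sqr.
have -> : t *: u + (1 - t) *: z - w = t *: (u - w) + (1 - t) *: (z - w).
  by apply/rowP => i; rewrite !mxE; ring.
rewrite norm_combo.
have -> : u - w - (z - w) = u - z by apply/rowP => i; rewrite !mxE; ring.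
rewrite (dotDr c) !(dotZr _ c).
move: hv; set pv := fine (P (_ + _)); set pu := fine (P u); set pz := fine (P z).
set du := dot (u - w) _; set dz := dot (z - w) _; set d := dot (u - z) _.
set cu := dot c u; set cz := dot c z => hv hmin.
have : g * pv <= g * (t * pu + (1 - t) * pz) by rewrite ler_wpM2l.
move=> hg; rewrite -(ler_pM2l t0); lra.
Qed.

Lemma prox_unique (g a : R) c w z z' : 0 <= g -> 0 < a ->
  is_prox g a c w z -> is_prox g a c w z' -> z = z'.
Proof.
move=> g0 a0 pz pz'; have [Dz mz] := pz; have [Dz' mz'] := pz'.
have := prox_three_point g a c w z z' g0 (ltW a0) pz Dz'; have := mz' z Dz.
rewrite l2norm_sqr => h1 h2.
have : a / 2 * dot (z' - z) (z' - z) <= 0 by lra.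
rewrite pmulr_rle0 ?divr_gt0// => h.
apply/esym/eqP; rewrite -subr_eq0; apply/eqP/dot_eq0/eqP.
by rewrite eq_le h dot_ge0.
Qed.

Lemma prox_objectiveE (f : V -> \bar R) (g a b : R) y z u : 0 < g -> domain P u ->
  prox_objective f P g a b y z u =
  (prox_value g a (grad f y) (b *: y + (1 - b) *: z) u)%:E.
Proof.
by move=> g0 Du; rewrite /prox_objective /prox_value opprD addrA (pccE u Du).
Qed.

(** The extended-real objective is [+oo] outside the domain of [P] and real
    inside, so its minimizers are those of its restriction. *)
Lemma is_argmin_prox (f : V -> \bar R) (g a b : R) y z s : 0 < g ->
  is_argmin (prox_objective f P g a b y z) s <->
  is_prox g a (grad f y) (b *: y + (1 - b) *: z) s.
Proof.
move=> g0.
have Poo u : ~ domain P u -> prox_objective f P g a b y z u = +oo%E.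
  rewrite /domain/= => /negP; rewrite -leNgt leye_eq => /eqP Pu.
  by rewrite /prox_objective Pu addey// gt0_muley ?lte_fin// addye.
split=> [amin|[Ds smin] u].
  have [x0 D0] : exists x, domain P x by case: hP => -[].
  have Ds : domain P s.
    apply: contrapT => /Poo Ps; have := amin x0.
    by rewrite Ps prox_objectiveE// leye_eq.
  by split=> // u Du; have := amin u; rewrite !prox_objectiveE// lee_fin.
have [Du|/Poo ->] := pselect (domain P u); last exact: leey.
by rewrite !prox_objectiveE// lee_fin smin.
Qed.

End Prox.

(** * The scalar equation for alpha *)

Section Scalars.
Context {R : realType}.
Implicit Types mu gp ap g a b : R.

(** The equation reads [a * (gp * a + B) = ap ^+ 2 * g], whose right-hand side
    is positive; hence [gp * a + B] is positive at a positive root. Subtracting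
    two such equations gives [(a1 - a2) * (gp * a2 + (gp * a1 + B)) = 0], where
    the second factor is positive. *)
Lemma alpha_solution_unique mu gp ap g a1 a2 : 0 < gp -> 0 < ap -> 0 < g ->
  alpha_solution mu gp ap g a1 -> alpha_solution mu gp ap g a2 -> a1 = a2.
Proof.
move=> gp0 ap0 g0 [/andP[a10 _] e1] [/andP[a20 _] e2].
have c0 : 0 < ap ^+ 2 * g by rewrite mulr_gt0 ?exprn_gt0.
pose B := ap ^+ 2 * g - mu * g * gp.
have f1 : a1 * (gp * a1 + B) = ap ^+ 2 * g by rewrite /B; lra.
have f2 : a2 * (gp * a2 + B) = ap ^+ 2 * g by rewrite /B; lra.
have p1 : 0 < gp * a1 + B by rewrite -(pmulr_rgt0 _ a10) f1.
have : (a1 - a2) * (gp * a2 + (gp * a1 + B)) = 0 by lra.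
move=> /eqP; rewrite mulf_eq0 => /orP[|/eqP h]; first by rewrite subr_eq0 => /eqP.
have : 0 < gp * a2 + (gp * a1 + B) by rewrite addr_gt0// mulr_gt0.
by rewrite h ltxx.
Qed.

(** The quadratic [gp * a ^+ 2 + B * a - ap ^+ 2 * g] is negative at 0 and,
    thanks to [mu * g <= 1], nonnegative at 1, so its larger root is in
    [0, 1], 0 excluded. *)
Lemma alpha_solution_exists mu gp ap g : 0 <= mu -> 0 < gp -> 0 < ap -> 0 < g ->
  mu * g <= 1 -> exists a, alpha_solution mu gp ap g a.
Proof.
move=> mu0 gp0 ap0 g0 mug.
have c0 : 0 < ap ^+ 2 * g by rewrite mulr_gt0 ?exprn_gt0.
pose B := ap ^+ 2 * g - mu * g * gp.
pose D := B ^+ 2 + 4 * gp * (ap ^+ 2 * g).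
have D0 : 0 <= D by rewrite addr_ge0 ?sqr_ge0// !mulr_ge0// ltW.
have sD := sqr_sqrtr D0; have s0 := sqrtr_ge0 D; set s := Num.sqrt D in sD s0.
have gc : 0 < gp * (ap ^+ 2 * g) by rewrite mulr_gt0.
have sB : B < s.
  have [Bn|Bp] := ltP B 0; first exact: lt_le_trans s0.
  by rewrite -(@ltr_pXn2r _ 2)// sD /D; lra.
have gmu : 0 <= gp * (1 - mu * g) by rewrite mulr_ge0 ?subr_ge0 ?(ltW gp0).
have s1 : s <= 2 * gp + B.
  rewrite -(@ler_pXn2r _ 2) ?nnegrE//; last by rewrite /B; lra.
  have : 0 <= gp * (gp * (1 - mu * g)) by rewrite mulr_ge0// ltW.
  by rewrite sD /D /B; lra.
have g2 : 0 < 2 * gp by rewrite mulr_gt0.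
exists ((s - B) / (2 * gp)); split.
  by rewrite divr_gt0 ?subr_gt0//= ler_pdivrMr// mul1r lerBlDr.
set a := _ / _; have ha : 2 * gp * a = s - B by rewrite /a mulrC divfK ?gt_eqF.
have hs : s = 2 * gp * a + B by rewrite ha subrK.
have : 4 * gp * (gp * a ^+ 2 + B * a - ap ^+ 2 * g) = 0.
  have -> : 4 * gp * (gp * a ^+ 2 + B * a - ap ^+ 2 * g) = (2 * gp * a + B) ^+ 2 - D.
    by rewrite /D; ring.
  by rewrite -hs sD subrr.
move=> /eqP; rewrite mulf_eq0 mulf_eq0 pnatr_eq0 (gt_eqF gp0) /= => /eqP.
by rewrite /B; lra.
Qed.

(** The form in which the equation for alpha is used: it makes the weights of
    the Lyapunov function match. *)
Lemma alpha_weight mu gp ap g a : 0 < gp -> 0 < g -> alpha_solution mu gp ap g a ->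
  a ^+ 2 / (2 * g) = (1 - a) * (ap ^+ 2 / (2 * gp)) + a * mu / 2.
Proof.
move=> gp0 g0 [_ e].
have -> : a ^+ 2 / (2 * g) = (gp * a ^+ 2) / (2 * g * gp).
  by field; rewrite !gt_eqF.
by rewrite e; field; rewrite !gt_eqF.
Qed.

(** The equation writes [a ^+ 2 / g] as the convex combination of
    [ap ^+ 2 / gp >= mu] and [mu] with weights [1 - a] and [a]. This keeps
    [beta] in [0, 1]. *)
Lemma alpha_solution_lower mu gp ap g a : 0 <= mu -> 0 < gp -> 0 < g ->
  mu * gp <= ap ^+ 2 -> alpha_solution mu gp ap g a -> mu * g <= a ^+ 2.
Proof.
move=> mu0 gp0 g0 h [/andP[a0 a1] e].
have : 0 <= (1 - a) * g * (ap ^+ 2 - mu * gp).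
  by rewrite !mulr_ge0 ?subr_ge0// ltW.
by move=> h1; rewrite -(ler_pM2l gp0) e; lra.
Qed.

End Scalars.

(** * The extrapolated point *)

Section Extrapolation.
Context {R : realType} {n : nat}.
Implicit Types x y z : 'rV[R]_n.

(** The first identity carries no information in the degenerate case
    [a = b = 1], where both sides vanish, yet it is the only one needed to
    compute [x' - y]; membership in convex sets uses the second part. *)
Lemma extrapolation_combo (gp ap g a b : R) x z :
  0 < gp -> 0 < g -> 0 < ap -> 0 < a <= 1 -> 0 <= b <= 1 ->
  (1 - a * b = 0 -> a = 1) ->
  let y := extrapolation gp ap g a b x z in
  (1 - a * b) *: y = (1 - a) *: x + (a * (1 - b)) *: z /\
  exists2 t, 0 <= t <= 1 & y = t *: x + (1 - t) *: z.
Proof.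
move=> gp0 g0 ap0 /andP[a0 a1] /andP[b0 b1] deg /=; rewrite /extrapolation.
case: eqP => [ab|/eqP ab].
  have a1' := deg ab; have b1' : b = 1 by move: ab; rewrite a1'; lra.
  split; first by rewrite ab a1' b1' !subrr mulr0 !scale0r addr0.
  have u0 : 0 < a * gp by rewrite mulr_gt0.
  have v0 : 0 < ap ^+ 2 * g by rewrite mulr_gt0 ?exprn_gt0.
  have uv : 0 < a * gp + ap ^+ 2 * g by rewrite addr_gt0.
  exists (a * gp / (a * gp + ap ^+ 2 * g)).
    by rewrite divr_ge0 ?(ltW u0) ?(ltW uv)//= ler_pdivrMr// mul1r lerDl ltW.
  by apply/rowP => i; rewrite !mxE; field; rewrite gt_eqF.
have ab1 : a * b <= 1 by rewrite mulr_ile1// ltW.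
have c0 : 0 < 1 - a * b by rewrite lt_def ab subr_ge0.
split; first by rewrite scalerA mulfV// scale1r.
exists ((1 - a) / (1 - a * b)).
  by rewrite divr_ge0 ?subr_ge0//= ler_pdivrMr// mul1r lerD2l lerN2 ler_piMr// ltW.
by apply/rowP => i; rewrite !mxE; field.
Qed.

End Extrapolation.

(** * One step of the method *)

(** Function values, scalar products and norms become real variables first, so
    that linear arithmetic never compares two of them by unfolding. *)
Ltac abstract_lra := repeat match goal with
  | H : is_true (_ <= _) |- _ => revert H | H : is_true (_ < _) |- _ => revert H
  end; repeat match goal with
  | |- context [fine ?e] => generalize (fine e); intro
  | |- context [dot ?u ?v] => generalize (dot u v); intro
  | |- context [l2norm ?u] => generalize (l2norm u); intro
  end; lra.

Lemma three_point_identity (R : realType) (n : nat) (z w u : 'rV[R]_n) :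
  l2norm (z - w) ^+ 2 + l2norm (u - z) ^+ 2 - l2norm (u - w) ^+ 2 =
  2 * (l2norm (z - u) ^+ 2 - dot (w - u) (z - u)).
Proof.
by rewrite !l2norm_sqr !dotE (dotC u z) (dotC w z) (dotC w u); ring.
Qed.

Section Method.
Context {R : realType} {n : nat}.
Notation V := 'rV[R]_n.
Implicit Types x y z u v : V.
Variables (f P : V -> \bar R) (mu gamma0 alpha0 delta : R) (x1 xstar : V).
Hypotheses (hP : proper_closed_convex P)
  (hdiff : forall x, closure (domain P) x -> ediff f x)
  (hlip : grad_locally_lipschitz_on f (closure (domain P)))
  (hf_gtNy : forall x, (-oo < f x)%E)
  (hstar_fin : objective f P xstar \is a fin_num)
  (hstar : is_argmin (objective f P) xstar)
  (hmu0 : 0 <= mu) (hmu : convexity_parameter_on f (domain P) mu).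

Let D := domain P.
Let fval x : R := fine (f x).
Let Pval x : R := fine (P x).
Let gap x := (fval x + Pval x) - (fval xstar + Pval xstar).

Lemma dom_ediff x : D x -> ediff f x.
Proof. by move=> Dx; apply: hdiff; apply: subset_closure. Qed.

Lemma dom_ffin x : D x -> f x \is a fin_num.
Proof. by move=> /dom_ediff[/nbhs_singleton]. Qed.

Lemma grad_ineq x y : D x -> D y ->
  fval x + dot (grad f x) (y - x) + mu / 2 * l2norm (x - y) ^+ 2 <= fval y.
Proof.
move=> Dx Dy; have := hmu x y Dx.
by rewrite -(fineK (dom_ffin x Dx)) -(fineK (dom_ffin y Dy)) -EFinD lee_fin addrA.
Qed.

Lemma grad_ineq0 x y : D x -> D y -> fval x + dot (grad f x) (y - x) <= fval y.
Proof.
move=> Dx Dy; apply: le_trans (grad_ineq x y Dx Dy).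
by rewrite lerDl mulr_ge0 ?sqr_ge0// divr_ge0.
Qed.

Lemma dom_xstar : D xstar.
Proof.
move: hstar_fin; rewrite /objective /D /domain/= fin_numE => /andP[_].
have := hf_gtNy xstar; case: (P xstar) => //= [r|]; first by rewrite ltry.
by case: (f xstar).
Qed.

Lemma objectiveE x : D x -> objective f P x = (fval x + Pval x)%:E.
Proof.
by move=> Dx; rewrite /objective -(fineK (dom_ffin x Dx)) (pccE P hP x Dx).
Qed.

Lemma gap_ge0 x : D x -> 0 <= gap x.
Proof.
move=> Dx; have := hstar x; rewrite (objectiveE _ Dx) (objectiveE _ dom_xstar) lee_fin.
by rewrite subr_ge0.
Qed.

Definition dom_ball (r : R) : set V := [set x | domain P x /\ l2norm (x - xstar) <= r].

Lemma dom_ball_convex r x y (t : R) : 0 <= t <= 1 -> dom_ball r x -> dom_ball r y ->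
  dom_ball r (t *: x + (1 - t) *: y).
Proof.
move=> t01 [Dx hx] [Dy hy]; split; first by have [] := pcc_convex P hP x y t t01 Dx Dy.
have -> : t *: x + (1 - t) *: y - xstar = t *: (x - xstar) + (1 - t) *: (y - xstar).
  by apply/rowP => i; rewrite !mxE; ring.
exact: l2norm_combo_le.
Qed.

Lemma dom_ball_lipschitz r : exists2 L : R, 0 < L & grad_lipschitz_on f L (dom_ball r).
Proof.
have cK : compact (closure D `&` [set x | `|xstar - x| <= r]).
  rewrite setIC; apply: compact_closedI; first exact: compact_sup_ball.
  exact: closed_closure.
have [x [cx _]|L L0 hL] := lipschitz_on_compact (grad f) _ cK.
  by have [L [U [L0 oU Ux _ lip]]] := hlip x cx; exists L, U.
exists L => // x y [Dx hx] [Dy hy]; apply: hL.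
  by split; [exact: subset_closure|rewrite /= distrC (le_trans (norm_le_l2norm _))].
by split; [exact: subset_closure|rewrite /= distrC (le_trans (norm_le_l2norm _))].
Qed.

(** Compare [xstar] with [v = t *: u + (1 - t) *: xstar]. The gradient
    inequality at [v], rather than a derivative at [xstar], bounds the increase
    of [f] by [t * dot (grad f v) d]; the gradient at [v] then tends to that at
    [xstar] with [t]. *)
Lemma xstar_optimality u : D u ->
  Pval xstar <= Pval u + dot (grad f xstar) (u - xstar).
Proof.
move=> Du; set d := u - xstar.
have [L L0 hL] := dom_ball_lipschitz (l2norm d).
have bs : dom_ball (l2norm d) xstar.
  split; first exact: dom_xstar.
  by rewrite subrr -(scale0r 0) l2normZ normr0 mul0r l2norm_ge0.
have bu : dom_ball (l2norm d) u by split.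
apply: (@le_of_near0 _ _ _ (L * l2norm d ^+ 2)) => t t0 t1.
have t01 : 0 <= t <= 1 by rewrite t1 ltW.
have bv := dom_ball_convex _ _ _ t t01 bu bs.
have [_ hv] := pcc_convex P hP u xstar t t01 Du dom_xstar.
set v := _ + _ in bv hv; have [Dv _] := bv.
have vx : v - xstar = t *: d by rewrite /v /d; apply/rowP => i; rewrite !mxE; ring.
have g1 := gap_ge0 v Dv; have g2 := grad_ineq0 v xstar Dv dom_xstar.
have dv : dot (grad f v) (xstar - v) = - (t * dot (grad f v) d).
  by rewrite -(opprB v xstar) vx dotNr dotZr.
rewrite dv in g2.
have l1 := hL _ _ bv bs; rewrite vx l2normZ ger0_norm in l1; last exact: ltW.
have cs := cauchy_schwarz (grad f v - grad f xstar) d; rewrite dotDl dotNl in cs.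
have l2 : l2norm (grad f v - grad f xstar) * l2norm d <= L * (t * l2norm d) * l2norm d.
  by rewrite ler_wpM2r ?l2norm_ge0.
have h : t * Pval xstar <= t * (Pval u + dot (grad f v) d).
  by move: g1 g2 hv; rewrite /gap /Pval /fval; clear l1 cs l2; abstract_lra.
rewrite ler_pM2l// in h; move: h cs l2; rewrite /Pval; abstract_lra.
Qed.

Hypotheses (hgamma0 : 0 < gamma0) (halpha0 : 0 < alpha0).

Definition rho : R := Num.sqrt (2 * gamma0) * r0 f P gamma0 alpha0 x1 xstar / alpha0.

Lemma setShatE LS :
  setShat f P gamma0 alpha0 x1 xstar LS = dom_ball ((1 + gamma0 * LS) * rho).
Proof. by rewrite /setShat /rho !mulrA. Qed.

Lemma rho_ge0 : 0 <= rho.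
Proof. by rewrite divr_ge0 ?mulr_ge0 ?sqrtr_ge0// ltW. Qed.

(** The last condition bounds the Lyapunov function by its weight times
    [rho ^+ 2]; as [gap] is nonnegative, it keeps [z] in the ball of radius
    [rho]. *)
Definition invariant (gp ap : R) x z : Prop :=
  [/\ 0 < gp, 0 < ap, mu * gp <= ap ^+ 2, dom_ball rho x /\ dom_ball rho z &
   gap x + ap ^+ 2 / (2 * gp) * l2norm (z - xstar) ^+ 2 <=
     ap ^+ 2 / (2 * gp) * rho ^+ 2].

Lemma dom_ball_sqr r q x : 0 <= r -> 0 < q -> D x ->
  q * l2norm (x - xstar) ^+ 2 <= q * r ^+ 2 -> dom_ball r x.
Proof.
move=> r0 q0 Dx; rewrite ler_pM2l// => h; split => //.
by rewrite -(@ler_pXn2r _ 2) ?nnegrE ?l2norm_ge0.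
Qed.

Section Trial.
Variables (gp ap : R) (x z : V) (g : R).
Hypotheses (inv : invariant gp ap x z) (g_gt0 : 0 < g).

Lemma momentum_bounds a : alpha_solution mu gp ap g a ->
  [/\ 0 < a <= 1, 0 <= mu * g * a^-1 <= 1, a * (mu * g * a^-1) = mu * g &
      1 - a * (mu * g * a^-1) = 0 -> a = 1].
Proof.
have [gp0 ap0 mugp _ _] := inv.
move=> sa; have [/andP[a0 a1] _] := sa.
have am := alpha_solution_lower mu gp ap g a hmu0 gp0 g_gt0 mugp sa.
have ab : a * (mu * g * a^-1) = mu * g by rewrite mulrCA mulfV ?mulr1 ?gt_eqF.
split => //; first by rewrite a0.
  rewrite divr_ge0 ?mulr_ge0 ?(ltW a0) ?(ltW g_gt0)//= ler_pdivrMr// mul1r.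
  apply: (le_trans am); by rewrite expr2 ler_piMr// ltW.
by rewrite ab => m1; apply/eqP; rewrite eq_le a1/= ; nra.
Qed.

Lemma extrapolation_spec a : alpha_solution mu gp ap g a ->
  let b := mu * g * a^-1 in let y := extrapolation gp ap g a b x z in
  (1 - a * b) *: y = (1 - a) *: x + (a * (1 - b)) *: z /\ dom_ball rho y.
Proof.
move=> sa; have [a01 b01 _ deg] := momentum_bounds a sa.
have [gp0 ap0 _ [Sx Sz] _] := inv.
have [e [t t01 yE]] := extrapolation_combo gp ap g a _ x z gp0 g_gt0 ap0 a01 b01 deg.
split; first exact: e.
by rewrite /= yE; exact: dom_ball_convex.
Qed.

Lemma trial_exists_unique : mu * g <= 1 -> exists! s, is_trial f P mu gp ap x z g s.
Proof.
move=> mug; have [gp0 ap0 _ _ _] := inv.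
have [a sa] := alpha_solution_exists mu gp ap g hmu0 gp0 ap0 g_gt0 mug.
have [/andP[a0 a1] _] := sa.
pose b := mu * g * a^-1; pose y := extrapolation gp ap g a b x z.
have [z' pz'] := prox_exists P hP g a (grad f y) (b *: y + (1 - b) *: z) g_gt0 a0.
exists (Trial a b y z' ((1 - a) *: x + a *: z')); split.
  split => //=; exact/is_argmin_prox.
move=> [a' b' y' z'' x'] [/= sa' -> -> am ->].
have ea := alpha_solution_unique mu gp ap g a a' gp0 ap0 g_gt0 sa sa'; subst a'.
have pz'' := (is_argmin_prox P hP f g a b y z z'' g_gt0).1 am.
by have -> := prox_unique P hP _ _ _ _ _ _ (ltW g_gt0) a0 pz' pz''.
Qed.

Variable s : @trial R n.
Hypothesis ts : is_trial f P mu gp ap x z g s.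
Let a := tr_alpha s.
Let b := tr_beta s.
Let y := tr_y s.
Let z' := tr_z s.
Let x' := tr_x s.
Let w : V := b *: y + (1 - b) *: z.

(** The identity for [x' - y] is what makes the quadratic terms of the line
    search and of the proximal step cancel. *)
Lemma trialP : [/\ alpha_solution mu gp ap g a, 0 < a <= 1, 0 <= b <= 1 &
  [/\ a * b = mu * g, is_prox P g a (grad f y) w z', dom_ball rho y,
  x' = (1 - a) *: x + a *: z' & x' - y = a *: (z' - w)]].
Proof.
have [sa bE yE am xE] := ts.
have [a01 b01 ab _] := momentum_bounds _ sa.
have [e Sy] := extrapolation_spec _ sa.
rewrite -bE -yE in b01 ab e Sy.
split => //; split => //; first exact/is_argmin_prox.
rewrite /x' xE /w scalerBr scalerDr !scalerA -/a -/z'.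
move: e; rewrite scalerBl scale1r => /eqP; rewrite subr_eq => /eqP e.
by rewrite {1}/y e -/a -/b -/y; apply/rowP => i; rewrite !mxE; ring.
Qed.

Lemma trial_dom : [/\ D y, D z' & D x'].
Proof.
have [_ /andP[a0 a1] _ [_ [Dz' _] [Dy _] xE _]] := trialP.
have [_ _ _ [[Dx _] _] _] := inv.
split=> //; rewrite xE.
have a01 : 0 <= 1 - a <= 1 by rewrite subr_ge0 a1 lerBlDr lerDl ltW.
by have [] := pcc_convex P hP x z' (1 - a) a01 Dx Dz'; rewrite subKr.
Qed.

Lemma acceptedE : accepted f g s <->
  2 * g * (fval x' - fval y - dot (grad f y) (x' - y)) <= l2norm (x' - y) ^+ 2.
Proof.
have [Dy _ Dx'] := trial_dom.
rewrite /accepted -/x' -/y -(fineK (dom_ffin x' Dx')) -(fineK (dom_ffin y Dy)).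
by rewrite -!EFinB -EFinM lee_fin.
Qed.

(** The sum of [(1 - a)] times the gradient inequality from [y] to [x], [a]
    times the strong one from [y] to [xstar], and [a / g] times the three-point
    inequality. *)
Lemma lyapunov_decrease : accepted f g s ->
  gap x' + a ^+ 2 / (2 * g) * l2norm (z' - xstar) ^+ 2 <=
  (1 - a) * (gap x + ap ^+ 2 / (2 * gp) * l2norm (z - xstar) ^+ 2).
Proof.
move=> /acceptedE acc.
have [sa /andP[a0 a1] /andP[b0 b1] [ab pz _ xE xyE]] := trialP.
have [Dy Dz' Dx'] := trial_dom.
have [gp0 ap0 _ [[Dx _] [Dz _]] _] := inv.
have Ds := dom_xstar.
have qE := alpha_weight mu gp ap g a gp0 g_gt0 sa.
set q := a ^+ 2 / (2 * g) in qE *; set qp := ap ^+ 2 / (2 * gp) in qE *.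
have qb : q * b = a * mu / 2.
  have -> : b = mu * g / a by rewrite -ab [a * b]mulrC mulfK ?gt_eqF.
  by rewrite /q; field; rewrite !gt_eqF.
have three := prox_three_point P hP g a _ w z' xstar (ltW g_gt0) (ltW a0) pz Ds.
have g2 : 0 < 2 * g by rewrite mulr_gt0.
have acc' : fval x' - fval y - dot (grad f y) (x' - y) <= q * l2norm (z' - w) ^+ 2.
  rewrite -(ler_pM2l g2); apply: le_trans acc _.
  rewrite xyE l2normZ exprMn real_normK ?num_real// /q le_eqVlt.
  apply/orP; left; apply/eqP.
  by field; rewrite gt_eqF.
have a01 : 0 <= 1 - a <= 1 by rewrite subr_ge0 a1 lerBlDr lerDl ltW.
have [_ px'] := pcc_convex P hP x z' (1 - a) a01 Dx Dz'.
rewrite subKr -xE in px'.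
have gx := grad_ineq0 y x Dy Dx.
have gs := grad_ineq y xstar Dy Ds.
have dlin : dot (grad f y) (x' - y) =
    (1 - a) * dot (grad f y) (x - y) + a * dot (grad f y) (z' - y).
  by rewrite xE !dotE; ring.
have wst : l2norm (xstar - w) ^+ 2 <=
    b * l2norm (xstar - y) ^+ 2 + (1 - b) * l2norm (xstar - z) ^+ 2.
  rewrite !l2norm_sqr.
  have -> : xstar - w = b *: (xstar - y) + (1 - b) *: (xstar - z).
    by rewrite /w; apply/rowP => i; rewrite !mxE; ring.
  by rewrite norm_combo lerBlDr lerDl !mulr_ge0 ?subr_ge0 ?dot_ge0.
have three' : a * (dot (grad f y) z' + Pval z') + q * l2norm (z' - w) ^+ 2
    + q * l2norm (z' - xstar) ^+ 2 <=
    a * (dot (grad f y) xstar + Pval xstar) + q * l2norm (xstar - w) ^+ 2.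
  have ag : 0 < a / g by rewrite divr_gt0.
  move: three; rewrite /prox_value -(ler_pM2l ag) (l2norm_distC xstar z') -/(Pval _) -/(Pval _).
  rewrite /q; congr (_ <= _); field; rewrite !gt_eqF//.
have q0 : 0 <= q by rewrite divr_ge0 ?sqr_ge0// ltW.
have wst' := ler_wpM2l q0 wst.
rewrite mulrDr !mulrA qb (_ : q * (1 - b) = (1 - a) * qp) in wst'; last first.
  by rewrite mulrBr mulr1 qb qE addrK.
rewrite (l2norm_distC z xstar).
have gx' : (1 - a) * (fval y + dot (grad f y) (x - y)) <= (1 - a) * fval x.
  by apply: ler_wpM2l; rewrite ?subr_ge0.
have gs' := ler_wpM2l (ltW a0) gs; rewrite (l2norm_distC y) in gs'.
move: three' acc' px' wst' gx' gs'; rewrite dlin /gap /Pval /fval !(dotDr, dotNr).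
abstract_lra.
Qed.

Lemma invariant_next : accepted f g s -> invariant g a x' z'.
Proof.
move=> acc; have ly := lyapunov_decrease acc.
have [sa /andP[a0 a1] _ [_ _ _ xE _]] := trialP.
have [Dy Dz' Dx'] := trial_dom.
have [gp0 ap0 mugp [Sx Sz] pot] := inv.
have q0 : 0 < a ^+ 2 / (2 * g) by rewrite divr_gt0 ?exprn_gt0 ?mulr_gt0.
have pot' : gap x' + a ^+ 2 / (2 * g) * l2norm (z' - xstar) ^+ 2 <=
    a ^+ 2 / (2 * g) * rho ^+ 2.
  apply: (le_trans ly).
  apply: le_trans (_ : (1 - a) * (ap ^+ 2 / (2 * gp) * rho ^+ 2) <= _).
    by rewrite ler_wpM2l// subr_ge0.
  rewrite mulrA ler_wpM2r ?sqr_ge0// (alpha_weight mu gp ap g a gp0 g_gt0 sa) lerDl.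
  by rewrite divr_ge0// mulr_ge0// ltW.
have Sz' : dom_ball rho z'.
  apply: (dom_ball_sqr _ (a ^+ 2 / (2 * g))) => //; first exact: rho_ge0.
  by apply: le_trans pot'; rewrite lerDr gap_ge0.
split => //; first exact: (alpha_solution_lower mu gp ap).
split => //; rewrite xE -{2}[a](subKr 1); apply: dom_ball_convex => //.
by rewrite subr_ge0 a1 lerBlDr lerDl ltW.
Qed.

(** Nonexpansiveness of the proximal map: [xstar] is the proximal point of the
    data shifted by its own gradient, and the two data differ by at most
    [rho + g / a * LS * rho]. The weight [a] of [z'] in [x'] cancels the
    denominator, so the bound does not depend on [a]. *)
Lemma trial_in_ball LS :
  g <= gamma0 -> 0 < LS -> grad_lipschitz_on f LS (dom_ball rho) ->
  dom_ball ((1 + gamma0 * LS) * rho) x'.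
Proof.
move=> g_le LS0 lip.
have [sa /andP[a0 a1] /andP[b0 b1] [ab pz Sy xE _]] := trialP.
have [Dy Dz' Dx'] := trial_dom.
have [_ _ _ [[Dx hx] [Dz hz]] _] := inv.
have Ds := dom_xstar.
split => //.
have [_ hy] := Sy.
have Ss : dom_ball rho xstar.
  by split => //; rewrite subrr -(scale0r 0) l2normZ normr0 mul0r rho_ge0.
have three := prox_three_point P hP g a _ w z' xstar (ltW g_gt0) (ltW a0) pz Ds.
have opt := ler_wpM2l (ltW g_gt0) (xstar_optimality z' Dz').
have three_id := three_point_identity _ _ z' w xstar.
have key : a * l2norm (z' - xstar) ^+ 2 <= a * dot (w - xstar) (z' - xstar)
    + g * dot (- (grad f y - grad f xstar)) (z' - xstar).
  have gd : dot (- (grad f y - grad f xstar)) (z' - xstar) =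
      dot (grad f xstar) (z' - xstar) + dot (grad f y) xstar - dot (grad f y) z'.
    by move: (grad f y) (grad f xstar) => A B; rewrite !dotE; ring.
  have a3 : a * (2 * (l2norm (z' - xstar) ^+ 2 - dot (w - xstar) (z' - xstar))) <=
      a * (l2norm (z' - w) ^+ 2 + l2norm (xstar - z') ^+ 2 - l2norm (xstar - w) ^+ 2).
    by rewrite three_id.
  rewrite gd; move: three opt a3; rewrite /prox_value /Pval.
  abstract_lra.
set d := z' - xstar in key *; set dG := grad f y - grad f xstar in key *.
have c1 := cauchy_schwarz (w - xstar) d; have c2 := cauchy_schwarz (- dG) d.
rewrite l2normN in c2.
have lG : l2norm dG <= LS * rho.
  by apply: (le_trans (lip _ _ Sy Ss)); rewrite ler_pM2l.
have hw : l2norm (w - xstar) <= rho.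
  have -> : w - xstar = b *: (y - xstar) + (1 - b) *: (z - xstar).
    by rewrite /w; apply/rowP => i; rewrite !mxE; ring.
  by apply: l2norm_combo_le => //; rewrite b0.
have d0 := l2norm_ge0 d; have rho0 := rho_ge0.
have dle : a * l2norm d <= a * rho + g * (LS * rho).
  have [->|dn] := eqVneq (l2norm d) 0.
    have a0' := ltW a0; have g0' := ltW g_gt0; have LS0' := ltW LS0.
    rewrite mulr0.
    exact: addr_ge0 (mulr_ge0 a0' rho0) (mulr_ge0 g0' (mulr_ge0 LS0' rho0)).
  have dp : 0 < l2norm d by rewrite lt_def dn.
  have e1 : dot (w - xstar) d <= rho * l2norm d by apply: (le_trans c1); rewrite ler_pM2r.
  have e2 : dot (- dG) d <= LS * rho * l2norm d by apply: (le_trans c2); rewrite ler_pM2r.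
  have e1' := ler_wpM2l (ltW a0) e1; have e2' := ler_wpM2l (ltW g_gt0) e2.
  by rewrite -(ler_pM2r dp); lra.
have -> : x' - xstar = (1 - a) *: (x - xstar) + a *: d.
  by rewrite xE /d; apply/rowP => i; rewrite !mxE; ring.
apply: (le_trans (ler_l2normD _ _)); rewrite !l2normZ !ger0_norm ?subr_ge0 ?(ltW a0)//.
have : (1 - a) * l2norm (x - xstar) <= (1 - a) * rho by rewrite ler_wpM2l ?subr_ge0.
have : g * (LS * rho) <= gamma0 * (LS * rho) by rewrite ler_wpM2r// mulr_ge0// ltW.
lra.
Qed.

Lemma small_step_accepted LS L :
  g <= gamma0 -> 0 < LS -> grad_lipschitz_on f LS (dom_ball rho) ->
  grad_lipschitz_on f L (dom_ball ((1 + gamma0 * LS) * rho)) -> g * L <= 1 ->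
  accepted f g s.
Proof.
move=> g_le LS0 lip lip' gL; apply/acceptedE.
have Sx' := trial_in_ball LS g_le LS0 lip.
have [_ _ _ [_ _ [Dy hy] _ _]] := trialP.
have Sy : dom_ball ((1 + gamma0 * LS) * rho) y.
  by split=> //; apply: (le_trans hy); rewrite ler_peMl ?rho_ge0// lerDl mulr_ge0// ltW.
have dd := descent (dom_ball ((1 + gamma0 * LS) * rho)) fval (grad f) L
  (dom_ball_convex _) (fun u v Su Sv => grad_ineq0 u v Su.1 Sv.1) lip' y x' Sy Sx'.
have g2 : 0 <= 2 * g by rewrite mulr_ge0// ltW.
apply: (le_trans (ler_wpM2l g2 dd)).
have -> : 2 * g * (L / 2 * l2norm (x' - y) ^+ 2) = g * L * l2norm (x' - y) ^+ 2 by field.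
by rewrite ler_piMl// sqr_ge0.
Qed.

End Trial.

(** * Runs of the method *)

Hypotheses (hgamma0_mu : 0 < mu -> gamma0 <= 1 / mu)
  (halpha0_bounds : Num.sqrt (mu * gamma0) <= alpha0 <= 1)
  (hdelta : 0 < delta < 1) (hx1 : domain P x1).

Lemma invariant_init : invariant gamma0 alpha0 x1 x1.
Proof.
have q0 : 0 < alpha0 ^+ 2 / (2 * gamma0) by rewrite divr_gt0 ?exprn_gt0 ?mulr_gt0.
have /andP[sq _] := halpha0_bounds.
have e : gap x1 + alpha0 ^+ 2 / (2 * gamma0) * l2norm (x1 - xstar) ^+ 2 =
         alpha0 ^+ 2 / (2 * gamma0) * rho ^+ 2.
  have g2 : 0 <= 2 * gamma0 by rewrite mulr_ge0// ltW.
  have r2 : r0 f P gamma0 alpha0 x1 xstar ^+ 2 =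
      gap x1 + alpha0 ^+ 2 / (2 * gamma0) * l2norm (x1 - xstar) ^+ 2.
    rewrite /r0 (objectiveE _ hx1) (objectiveE _ dom_xstar) /= sqr_sqrtr//.
    by rewrite addr_ge0 ?gap_ge0// mulr_ge0 ?sqr_ge0// ltW.
  rewrite /rho expr_div_n exprMn (sqr_sqrtr g2) r2.
  by field; rewrite !gt_eqF.
have b : dom_ball rho x1.
  apply: (dom_ball_sqr _ (alpha0 ^+ 2 / (2 * gamma0))) => //; first exact: rho_ge0.
  by rewrite -e lerDr gap_ge0.
split => //; last by rewrite e.
by rewrite -(sqr_sqrtr (mulr_ge0 hmu0 (ltW hgamma0))) lerXn2r ?nnegrE ?sqrtr_ge0// ltW.
Qed.

Lemma line_search_step_bounds m :
  0 < gamma0 * delta ^+ m <= gamma0 /\ mu * (gamma0 * delta ^+ m) <= 1.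
Proof.
have /andP[d0 d1] := hdelta.
have g1 : gamma0 * delta ^+ m <= gamma0.
  by rewrite ler_piMr ?exprn_ile1 ?(ltW hgamma0)// ltW.
split; first by rewrite mulr_gt0 ?exprn_gt0.
apply: (@le_trans _ _ (mu * gamma0)); first by rewrite ler_wpM2l.
move: hmu0; rewrite le_eqVlt => /orP[/eqP <-|mp]; first by rewrite mul0r.
by rewrite mulrC -ler_pdivlMr// hgamma0_mu.
Qed.

Lemma exponent_of_bound L (m : nat) : 0 < L ->
  line_search_bound gamma0 delta L <= m%:Z -> gamma0 * delta ^+ m * L <= 1.
Proof.
have /andP[d0 d1] := hdelta.
move=> L0; rewrite /line_search_bound /ceil_plus ge_max ceil_le_int => /andP[h _].
have gL : 0 < gamma0 * L by rewrite mulr_gt0.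
have ld : 0 < ln (1 / delta) by rewrite ln_gt0// ltr_pdivlMr// mul1r.
move: h; rewrite ler_pdivrMr// => h.
have dm : 0 < delta ^+ m by rewrite exprn_gt0.
rewrite -mulrA (mulrC _ L) mulrA -ler_ln ?posrE ?mulr_gt0// ln1 lnM ?posrE// lnXn//.
move: h; rewrite div1r lnV ?posrE// -mulr_natr; lra.
Qed.

Lemma pass_at gp ap x z LS L m : invariant gp ap x z ->
  0 < LS -> grad_lipschitz_on f LS (dom_ball rho) ->
  grad_lipschitz_on f L (dom_ball ((1 + gamma0 * LS) * rho)) ->
  gamma0 * delta ^+ m * L <= 1 ->
  passes f P mu gamma0 delta gp ap x z m.
Proof.
move=> inv LS0 lip lip' gL; have [/andP[g0 g1] mug] := line_search_step_bounds m.
have [s [ts _]] := trial_exists_unique gp ap x z _ inv g0 mug.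
by exists s; split=> //; exact: (small_step_accepted gp ap x z _ inv g0 s ts LS L).
Qed.

Lemma line_search_bound_ge0 L : 0 <= line_search_bound gamma0 delta L.
Proof. by rewrite /line_search_bound /ceil_plus le_max lexx orbT. Qed.

Lemma passes_eventually gp ap x z : invariant gp ap x z ->
  exists m, passes f P mu gamma0 delta gp ap x z m.
Proof.
move=> inv; have [LS LS0 lip] := dom_ball_lipschitz rho.
have [L L0 lip'] := dom_ball_lipschitz ((1 + gamma0 * LS) * rho).
exists `|line_search_bound gamma0 delta L|%N; apply: (pass_at _ _ _ _ LS L) => //.
apply: exponent_of_bound => //; rewrite gez0_abs//; exact: line_search_bound_ge0.
Qed.

Lemma invariant_well_defined gp ap x z : invariant gp ap x z ->
  iteration_well_defined f P mu gamma0 delta gp ap x z.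
Proof.
move=> inv; split; last exact: passes_eventually.
  move=> m; have [/andP[g0 g1] mug] := line_search_step_bounds m.
  exact: (trial_exists_unique gp ap x z).
move=> m s ts; have [/andP[g0 g1] mug] := line_search_step_bounds m.
have [Dy _ Dx'] := trial_dom gp ap x z _ inv g0 s ts.
by split; [exact: dom_ediff|exact: dom_ffin].
Qed.

(** An iteration records a trial and the fact that some trial passes the test;
    by uniqueness of the trial, the recorded one does. *)
Lemma iteration_invariant e t :
  invariant (gam e t) (alp e t) (xs e t.+1) (zs e t.+1) ->
  iteration f P mu gamma0 delta e t.+1 ->
  invariant (gam e t.+1) (alp e t.+1) (xs e t.+2) (zs e t.+2) /\
  dom_ball rho (ys e t.+1).
Proof.
move=> inv [/= [s [ts acc]] _ gE tr].
have [/andP[g0 g1] mug] := line_search_step_bounds (nls e t.+1).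
rewrite -gE in g0 g1 mug ts acc.
have [s' [_ us]] := trial_exists_unique _ _ _ _ _ inv g0 mug.
have es := us _ ts; have et := us _ tr; subst s'.
rewrite et in ts acc.
split; first exact: (invariant_next _ _ _ _ _ inv g0 _ ts acc).
by have [_ _ _ [_ _ Sy _ _]] := trialP _ _ _ _ _ inv g0 _ ts.
Qed.

Lemma run_upto_invariant T e : run_upto f P mu gamma0 alpha0 delta x1 T e ->
  forall t, (t <= T)%N -> invariant (gam e t) (alp e t) (xs e t.+1) (zs e t.+1).
Proof.
move=> [[g0 a0 ex ez] it]; elim=> [_|t IH tT].
  by rewrite g0 a0 ex ez; exact: invariant_init.
by have [] := iteration_invariant e t (IH (ltnW tT)) (it t.+1 tT).
Qed.

Lemma run_invariant e : run f P mu gamma0 alpha0 delta x1 e ->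
  forall t, invariant (gam e t) (alp e t) (xs e t.+1) (zs e t.+1).
Proof.
move=> [st it] t; apply: (run_upto_invariant t) => //.
by split=> // k /andP[k1 _]; exact: it.
Qed.

(** The states (gamma, alpha, x, z) are iterated from the initial one. The
    choice function returns the least passing exponent and its trial at states
    satisfying the invariant, and anything elsewhere. *)
Lemma run_exists : exists e, run f P mu gamma0 alpha0 delta x1 e.
Proof.
pose state := (R * R * V * V)%type.
pose next (st : state) (ms : nat * @trial R n) : state :=
  (gamma0 * delta ^+ ms.1, tr_alpha ms.2, tr_x ms.2, tr_z ms.2).
pose inv (st : state) := let: (gp, ap, x, z) := st in invariant gp ap x z.
pose good (st : state) (ms : nat * @trial R n) := let: (gp, ap, x, z) := st in
  [/\ is_trial f P mu gp ap x z (gamma0 * delta ^+ ms.1) ms.2,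
      accepted f (gamma0 * delta ^+ ms.1) ms.2 &
      forall m, (m < ms.1)%N -> ~ passes f P mu gamma0 delta gp ap x z m].
have /choice[F hF] st : exists ms, inv st -> good st ms.
  move: st => [[[gp ap] x] z].
  have [i|ni] := pselect (invariant gp ap x z); last first.
    by exists (0, Trial 0 0 0 0 0).
  have ex : exists m, `[< passes f P mu gamma0 delta gp ap x z m >].
    by have [m hm] := passes_eventually gp ap x z i; exists m; apply/asboolP.
  have [m /asboolP[s [ts acc]] mmin] := ex_minnP ex.
  exists (m, s) => _; split=> // k km /asboolP/mmin; rewrite leqNgt => /negP; exact.
pose st k := iter k (fun st => next st (F st)) (gamma0, alpha0, x1, x1).
have stS k : st k.+1 = next (st k) (F (st k)) by [].
have invS k : inv (st k).
  elim: k => [|k IH]; first exact: invariant_init.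
  rewrite stS; have := hF _ IH; move: IH; case: (st k) => [[[gp ap] x] z] /= i.
  case: (F _) => m s /= [ts acc _]; have [/andP[g0 g1] mug] := line_search_step_bounds m.
  exact: (invariant_next gp ap x z).
(* [st k] is the state on which iteration [k.+1] acts, hence the shift. *)
exists (Execution (fun k => (st k).1.1.1) (fun k => (st k).1.1.2)
  (fun t => tr_beta (F (st t.-1)).2) (fun t => (F (st t.-1)).1)
  (fun t => (st t.-1).1.2) (fun t => tr_y (F (st t.-1)).2) (fun t => (st t.-1).2)).
split=> // -[//|t] _; rewrite /iteration /= -/(st t).
have := hF _ (invS t); case: (st t) => [[[gp ap] x] z] /=.
case: (F _) => m [a b y' z' x'] /= [ts acc mmin].
by split=> //; exists (Trial a b y' z' x').
Qed.

Lemma run_in_ball e t : run f P mu gamma0 alpha0 delta x1 e -> (1 <= t)%N ->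
  [/\ dom_ball rho (xs e t), dom_ball rho (ys e t) & dom_ball rho (zs e t)].
Proof.
case: t => // t re _; have inv := run_invariant e re t.
have [_ _ _ [Sx Sz] _] := inv; have [_ it] := re.
by have [_ Sy] := iteration_invariant e t inv (it t.+1 isT).
Qed.

Lemma run_exponent_bound LS L e t :
  0 < LS -> grad_lipschitz_on f LS (dom_ball rho) ->
  0 < L -> grad_lipschitz_on f L (dom_ball ((1 + gamma0 * LS) * rho)) ->
  run f P mu gamma0 alpha0 delta x1 e -> (1 <= t)%N ->
  (nls e t)%:Z <= line_search_bound gamma0 delta L.
Proof.
case: t => // t LS0 lip L0 lip' re _; have inv := run_invariant e re t.
have B0 := line_search_bound_ge0 L.
rewrite -(gez0_abs B0) lez_nat leqNgt; apply/negP => lt_nls.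
have [_ it] := re; have [_ mmin _ _] := it t.+1 isT.
apply: (mmin _ lt_nls); apply: (pass_at _ _ _ _ LS L) => //.
by apply: exponent_of_bound => //; rewrite gez0_abs.
Qed.

End Method.

Theorem theorem1 (R : realType) (n : nat) (f P : 'rV[R]_n -> \bar R)
    (mu gamma0 alpha0 delta : R) (x1 xstar : 'rV[R]_n)
    (hf : proper_closed_convex f) (hP : proper_closed_convex P)
    (hdiff : forall x, closure (domain P) x -> ediff f x)
    (hlip : grad_locally_lipschitz_on f (closure (domain P)))
    (hstar_fin : objective f P xstar \is a fin_num)
    (hstar : is_argmin (objective f P) xstar)
    (hmu0 : 0 <= mu) (hmu : convexity_parameter_on f (domain P) mu)
    (hgamma0 : 0 < gamma0) (hgamma0_mu : 0 < mu -> gamma0 <= 1 / mu)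
    (halpha0 : 0 < alpha0)
    (halpha0_bounds : Num.sqrt (mu * gamma0) <= alpha0 <= 1)
    (hdelta : 0 < delta < 1)
    (hx1 : domain P x1) :
  let S := setS f P gamma0 alpha0 x1 xstar in
  let Shat := setShat f P gamma0 alpha0 x1 xstar in
  let is_run := run f P mu gamma0 alpha0 delta x1 in
  [/\ (forall (T : nat) (e : execution),
         run_upto f P mu gamma0 alpha0 delta x1 T e ->
         iteration_well_defined f P mu gamma0 delta
           (gam e T) (alp e T) (xs e T.+1) (zs e T.+1)),
      (exists e : execution, is_run e),
      (forall e : execution, is_run e -> forall t : nat, (1 <= t)%N ->
         [/\ S (xs e t), S (ys e t) & S (zs e t)]),
      (exists2 LS : R, 0 < LS & grad_lipschitz_on f LS S) &
      forall LS : R, 0 < LS -> grad_lipschitz_on f LS S ->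
        (exists2 LShat : R, 0 < LShat & grad_lipschitz_on f LShat (Shat LS)) /\
        (forall LShat : R, 0 < LShat -> grad_lipschitz_on f LShat (Shat LS) ->
         forall e : execution, is_run e -> forall t : nat, (1 <= t)%N ->
           (nls e t)%:Z <= line_search_bound gamma0 delta LShat)].
Proof.
move=> S Shat is_run.
have hf_gtNy x : (-oo < f x)%E by case: hf => -[].
split.
- move=> T e rT.
  apply: (invariant_well_defined f P mu gamma0 alpha0 delta x1 xstar) => //.
  exact: (run_upto_invariant f P mu gamma0 alpha0 delta x1 xstar) rT T (leqnn T).
- exact: (run_exists f P mu gamma0 alpha0 delta x1 xstar).
- move=> e re t.
  exact: (run_in_ball f P mu gamma0 alpha0 delta x1 xstar) re.
- exact: dom_ball_lipschitz.
move=> LS LS0 lip; rewrite /Shat setShatE; split; first exact: dom_ball_lipschitz.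
move=> L L0 lip' e re t t1.
exact: (run_exponent_bound f P mu gamma0 alpha0 delta x1 xstar) LS0 lip L0 lip' re t1.
Qed.
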